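(* Let $r,s\geq 3$, let $g_1,\dots,g_r\geq 2$ and $h_1,\dots,h_s\geq 2$. The K\''ahler groups $\ker(\phi_{g_1,\dots,g_r})$ and $\ker(\psi_{h_1,\dots,h_s})$ are isomorphic if and only if $r=s$ and $g_1=\cdots=g_r=h_1=\cdots=h_r=2$.
   Context: For $g\geq 2$ let $\Lambda_g=\langle a_1,\dots,a_g,b_1,\dots,b_g\mid [a_1,b_1]\cdots[a_g,b_g]\rangle$ be the fundamental group of the closed orientable surface of genus $g$; for the $i$th factor of a product $\Lambda_{g_1}\times\cdots\times\Lambda_{g_r}$ write its generators as $a^i_1,\dots,a^i_{g_i},b^i_1,\dots,b^i_{g_i}$. Write $\mathbb{Z}^2=\langle a,b\mid[a,b]\rangle$. The homomorphism $\phi_{g_1,\dots,g_r}:\Lambda_{g_1}\times\cdots\times\Lambda_{g_r}\to\mathbb{Z}^2$ is given, for all $i$, by $a^i_1,a^i_2\mapsto a$, $b^i_1,b^i_2\mapsto b$, and $a^i_j,b^i_j\mapsto 0$ for $3\leq j\leq g_i$. The homomorphism $\psi_{h_1,\dots,h_s}:\Lambda_{h_1}\times\cdots\times\Lambda_{h_s}\to\mathbb{Z}^2$ is given by $a^i_j\mapsto a$, $b^i_j\mapsto b$ for all $i$ and all $1\leq j\leq h_i$. A K\''ahler group is the fundamental group of a compact K\''ahler manifold. *)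

(* Defs.v *)
From HB Require Import structures.
From mathcomp Require Import all_boot all_order all_algebra.
From mathcomp Require Import boolp.

Set Implicit Arguments.
Unset Strict Implicit.
Unset Printing Implicit Defensive.

Local Open Scope group_scope.
Local Open Scope quotient_scope.

(* A letter (x, false) stands for the generator x, and (x, true) for its
   inverse. *)
Definition word (X : Type) := seq (X * bool).

Definition gen_word (X : Type) (x : X) : word X := [:: (x, false)].

Definition inv_word (X : Type) (w : word X) : word X :=
  rev [seq (l.1, ~~ l.2) | l <- w].

(* Same convention as the library's [~ x, y] = x^-1 * y^-1 * x * y. *)
Definition comm_word (X : Type) (u v : word X) : word X :=
  inv_word u ++ inv_word v ++ u ++ v.

Section Presentation.

Variables (X : choiceType) (rels : seq (word X)).

Inductive pres_eq : word X -> word X -> Prop :=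
| pres_eq_refl u : pres_eq u u
| pres_eq_sym u v : pres_eq u v -> pres_eq v u
| pres_eq_trans u v w : pres_eq u v -> pres_eq v w -> pres_eq u w
| pres_eq_cat u u' v v' :
    pres_eq u u' -> pres_eq v v' -> pres_eq (u ++ v) (u' ++ v')
| pres_eq_cancel x e : pres_eq [:: (x, e); (x, ~~ e)] [::]
| pres_eq_rel u : u \in rels -> pres_eq u [::].

Definition pres_rel : rel (word X) := fun u v => `[< pres_eq u v >].

Lemma pres_rel_refl : reflexive pres_rel.
Proof. by move=> u; apply/asboolP; exact: pres_eq_refl. Qed.

Lemma pres_rel_sym : symmetric pres_rel.
Proof. by move=> u v; apply/asboolP/asboolP; exact: pres_eq_sym. Qed.

Lemma pres_rel_trans : transitive pres_rel.
Proof.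
move=> v u w /asboolP uv /asboolP vw; apply/asboolP.
exact: pres_eq_trans uv vw.
Qed.

Canonical pres_equiv :=
  EquivRel pres_rel pres_rel_refl pres_rel_sym pres_rel_trans.

(* The group <X | rels>. *)
Definition presented := {eq_quot pres_rel}.

HB.instance Definition _ := Choice.on presented.

Definition pres_class (u : word X) : presented := \pi_{eq_quot pres_rel} u.

Lemma pres_classP u v : pres_class u = pres_class v <-> pres_eq u v.
Proof. by split=> [/eqmodP/asboolP|uv] //; apply/eqmodP/asboolP. Qed.

Definition pres_repr (x : presented) : word X := repr (x : {eq_quot pres_rel}).

Lemma pres_reprK : cancel pres_repr pres_class.
Proof. by move=> x; exact: reprK. Qed.

Definition pres_one := pres_class [::].
Definition pres_mul x y := pres_class (pres_repr x ++ pres_repr y).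
Definition pres_inv x := pres_class (inv_word (pres_repr x)).

Lemma pres_repr_class u : pres_eq (pres_repr (pres_class u)) u.
Proof. by apply/pres_classP; rewrite pres_reprK. Qed.

Lemma pres_mul_class u v :
  pres_mul (pres_class u) (pres_class v) = pres_class (u ++ v).
Proof. by apply/pres_classP/pres_eq_cat; exact: pres_repr_class. Qed.

Lemma inv_wordK : involutive (@inv_word X).
Proof.
move=> u; rewrite /inv_word map_rev revK -map_comp -[RHS]map_id.
by apply: eq_map => -[x e] /=; rewrite negbK.
Qed.

Lemma pres_eq_inv_word u : pres_eq (inv_word u ++ u) [::].
Proof.
elim: u => [|[x e] u IHu]; first exact: pres_eq_refl.
rewrite /inv_word /= rev_cons -cats1 -/(inv_word u).
rewrite -cat_rcons -cats1 -!catA.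
apply: pres_eq_trans IHu; apply: pres_eq_cat; first exact: pres_eq_refl.
apply: (@pres_eq_cat [:: (x, ~~ e); (x, e)] [::] u u); last exact: pres_eq_refl.
by rewrite -{2}[e]negbK; exact: pres_eq_cancel.
Qed.

Lemma pres_mulA : associative pres_mul.
Proof.
move=> x y z; rewrite -[x]pres_reprK -[y]pres_reprK -[z]pres_reprK.
by rewrite !pres_mul_class catA.
Qed.

Lemma pres_mul1 : left_id pres_one pres_mul.
Proof. by move=> x; rewrite -[x]pres_reprK pres_mul_class. Qed.

Lemma pres_mulr1 : right_id pres_one pres_mul.
Proof. by move=> x; rewrite -[x]pres_reprK pres_mul_class cats0. Qed.

Lemma pres_mulV : left_inverse pres_one pres_inv pres_mul.
Proof.
move=> x; rewrite -{2}[x]pres_reprK pres_mul_class.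
exact/pres_classP/pres_eq_inv_word.
Qed.

Lemma pres_mulrV : right_inverse pres_one pres_inv pres_mul.
Proof.
move=> x; rewrite -{1}[x]pres_reprK pres_mul_class; apply/pres_classP.
by rewrite -{1}[pres_repr x]inv_wordK; exact: pres_eq_inv_word.
Qed.

HB.instance Definition _ := isGroup.Build presented
  pres_mulA pres_mul1 pres_mulr1 pres_mulV pres_mulrV.

Definition pres_gen (x : X) : presented := pres_class (gen_word x).

End Presentation.

Lemma pres_class_cat (X : choiceType) (rels : seq (word X)) u v :
  pres_class rels (u ++ v) = pres_class rels u * pres_class rels v.
Proof. by rewrite [RHS]pres_mul_class. Qed.

Lemma pres_class_inv (X : choiceType) (rels : seq (word X)) u :
  pres_class rels (inv_word u) = (pres_class rels u)^-1.
Proof.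
apply: (mulIg (pres_class rels u)); rewrite mulVg -pres_class_cat.
exact/pres_classP/pres_eq_inv_word.
Qed.

Section Lift.

Variables (X : choiceType) (H : groupType) (f : X -> H).

Definition eval_word (w : word X) : H :=
  \prod_(l <- w) (if l.2 then (f l.1)^-1 else f l.1).

Lemma eval_word_cat u v : eval_word (u ++ v) = eval_word u * eval_word v.
Proof. exact: big_cat. Qed.

Lemma eval_word_gen x : eval_word (gen_word x) = f x.
Proof. exact: big_seq1. Qed.

Lemma eval_word_inv u : eval_word (inv_word u) = (eval_word u)^-1.
Proof.
elim: u => [|[x e] u IHu]; first by rewrite /eval_word !big_nil invg1.
rewrite /inv_word /= rev_cons -cats1 -/(inv_word u) eval_word_cat IHu.
rewrite /eval_word big_seq1 big_cons invgM /=.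
by case: e; rewrite /= ?invgK.
Qed.

Lemma eval_word_comm u v :
  eval_word (comm_word u v) = [~ eval_word u, eval_word v].
Proof. by rewrite !eval_word_cat !eval_word_inv. Qed.

Variable rels : seq (word X).

(* The homomorphism <X | rels> -> H sending each generator x to f x; it depends
   on the choice of pres_repr unless f sends every relator to 1. *)
Definition pres_lift (x : presented rels) : H := eval_word (pres_repr x).

Hypothesis f_rels : {in rels, forall u, eval_word u = 1}.

Lemma eval_word_pres_eq u v : pres_eq rels u v -> eval_word u = eval_word v.
Proof.
elim=> {u v} [//|u v _ -> //|u v w _ -> _ -> //|u u' v v' _ equ _ eqv|x e|u].
- by rewrite !eval_word_cat equ eqv.
- rewrite /eval_word big_cons big_seq1 big_nil /=.
  by case: e; rewrite /= ?mulgV ?mulVg.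
- by rewrite {2}/eval_word big_nil => /f_rels.
Qed.

Lemma pres_lift_class u : pres_lift (pres_class rels u) = eval_word u.
Proof. exact/eval_word_pres_eq/pres_repr_class. Qed.

Lemma pres_lift_gen x : pres_lift (pres_gen rels x) = f x.
Proof. by rewrite pres_lift_class eval_word_gen. Qed.

Lemma pres_liftM : {morph pres_lift : x y / x * y}.
Proof. by move=> x y; rewrite [LHS]pres_lift_class eval_word_cat. Qed.

End Lift.

(* The generators of the genus g surface group: inl j is a_(j+1) and inr j is
   b_(j+1), for j = 0, ..., g - 1. *)
Definition surface_relator (g : nat) : word ('I_g + 'I_g)%type :=
  \big[cat/[::]]_(j < g) comm_word (gen_word (inl j)) (gen_word (inr j)).

Definition surface_group (g : nat) : groupType :=
  presented [:: surface_relator g].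

Definition surface_a g (j : 'I_g) : surface_group g := pres_gen _ (inl j).
Definition surface_b g (j : 'I_g) : surface_group g := pres_gen _ (inr j).

Lemma surface_rel g : \prod_(j < g) [~ surface_a j, surface_b j] = 1.
Proof.
pose cl : word _ -> surface_group g := pres_class [:: surface_relator g].
have clM : {morph cl : u v / u ++ v >-> u * v} by exact: pres_class_cat.
have relE : cl (surface_relator g) = 1.
  by apply/pres_classP/pres_eq_rel; rewrite inE.
rewrite -[RHS]relE [RHS](big_morph cl clM (erefl : cl [::] = 1)).
by apply: eq_bigr => j _; rewrite !clM /cl !pres_class_inv.
Qed.

Definition Z2 : groupType := Algebra.to_multiplicative (int * int)%type.
Definition Z2a : Z2 := (1, 0)%R : int * int.
Definition Z2b : Z2 := (0, 1)%R : int * int.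

Lemma Z2_mulC (x y : Z2) : x * y = y * x.
Proof. exact: (@GRing.addrC (int * int)%type x y). Qed.

Definition surface_to_Z2 g (f : 'I_g + 'I_g -> Z2) : surface_group g -> Z2 :=
  pres_lift f (rels := [:: surface_relator g]).

Section SurfaceToZ2.

Variables (g : nat) (f : 'I_g + 'I_g -> Z2).

Lemma surface_relator_Z2 :
  {in [:: surface_relator g], forall u, eval_word f u = 1}.
Proof.
move=> u /[!inE] /eqP->; rewrite /surface_relator.
rewrite (big_morph _ (eval_word_cat f) (big_nil _ _ _ _)).
apply: big1 => j _; rewrite eval_word_comm.
by apply/eqP/commgP; exact: Z2_mulC.
Qed.

Lemma surface_to_Z2M : {morph surface_to_Z2 f : x y / x * y}.
Proof. exact: pres_liftM surface_relator_Z2. Qed.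

Lemma surface_to_Z2_a j : surface_to_Z2 f (surface_a j) = f (inl j).
Proof. exact: pres_lift_gen surface_relator_Z2 _. Qed.

Lemma surface_to_Z2_b j : surface_to_Z2 f (surface_b j) = f (inr j).
Proof. exact: pres_lift_gen surface_relator_Z2 _. Qed.

End SurfaceToZ2.

Section DirectProduct.

Variables (I : Type) (G : I -> groupType).

Definition dprodg := forall i, G i.

HB.instance Definition _ := gen_eqMixin dprodg.
HB.instance Definition _ := gen_choiceMixin dprodg.

Definition dprodg_one : dprodg := fun i => 1.
Definition dprodg_mul (x y : dprodg) : dprodg := fun i => x i * y i.
Definition dprodg_inv (x : dprodg) : dprodg := fun i => (x i)^-1.

Lemma dprodg_mulA : associative dprodg_mul.
Proof. by move=> x y z; apply: functional_extensionality_dep => i; exact: mulgA. Qed.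

Lemma dprodg_mul1 : left_id dprodg_one dprodg_mul.
Proof. by move=> x; apply: functional_extensionality_dep => i; exact: mul1g. Qed.

Lemma dprodg_mulr1 : right_id dprodg_one dprodg_mul.
Proof. by move=> x; apply: functional_extensionality_dep => i; exact: mulg1. Qed.

Lemma dprodg_mulV : left_inverse dprodg_one dprodg_inv dprodg_mul.
Proof. by move=> x; apply: functional_extensionality_dep => i; exact: mulVg. Qed.

Lemma dprodg_mulrV : right_inverse dprodg_one dprodg_inv dprodg_mul.
Proof. by move=> x; apply: functional_extensionality_dep => i; exact: mulgV. Qed.

HB.instance Definition _ := isGroup.Build dprodg
  dprodg_mulA dprodg_mul1 dprodg_mulr1 dprodg_mulV dprodg_mulrV.

End DirectProduct.

Definition surface_prod r (g : 'I_r -> nat) : groupType :=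
  dprodg (fun i => surface_group (g i)).

Definition surface_inj r (g : 'I_r -> nat) i (x : surface_group (g i)) :
    surface_prod g :=
  dfwith (fun j => 1 : surface_group (g j)) x.

(* The homomorphism on the product that restricts to surface_to_Z2 (f i) on the
   i-th factor. *)
Definition surface_prod_to_Z2 r (g : 'I_r -> nat)
    (f : forall i, 'I_(g i) + 'I_(g i) -> Z2) (x : surface_prod g) : Z2 :=
  \prod_(i < r) surface_to_Z2 (f i) (x i).

Section SurfaceProdToZ2.

Variables (r : nat) (g : 'I_r -> nat).
Variable f : forall i, 'I_(g i) + 'I_(g i) -> Z2.
Arguments f : clear implicits.

Lemma surface_prod_to_Z2M : {morph surface_prod_to_Z2 f : x y / x * y}.
Proof.
move=> x y; rewrite /surface_prod_to_Z2.
elim/big_rec3: _ => [|i u v w _ ->]; first by rewrite mulg1.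
rewrite surface_to_Z2M !mulgA; congr (_ * _).
by rewrite -!mulgA; congr (_ * _); exact: Z2_mulC.
Qed.

Lemma surface_prod_to_Z21 : surface_prod_to_Z2 f 1 = 1.
Proof.
by apply: (mulgI (surface_prod_to_Z2 f 1)); rewrite -surface_prod_to_Z2M !mulg1.
Qed.

Lemma surface_prod_to_Z2_inj i (x : surface_group (g i)) :
  surface_prod_to_Z2 f (surface_inj x) = surface_to_Z2 (f i) x.
Proof.
rewrite /surface_prod_to_Z2.
have to1 j : surface_to_Z2 (f j) 1 = 1.
  by apply: (mulgI (surface_to_Z2 (f j) 1)); rewrite -surface_to_Z2M !mulg1.
have out (s : seq 'I_r) : i \notin s ->
    \prod_(j <- s) surface_to_Z2 (f j) (surface_inj x j) = 1.
  elim: s => [|j s IHs]; first by rewrite big_nil.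
  rewrite inE negb_or big_cons => /andP[ij /IHs->].
  by rewrite mulg1 /surface_inj dfwith_out.
have: i \in index_enum 'I_r by rewrite mem_index_enum.
elim: (index_enum _) (index_enum_uniq 'I_r) => [//|j s IHs] /= /andP[js us].
rewrite inE big_cons; have [ij _|ij /= si] := eqVneq i j.
  by rewrite -ij in js *; rewrite out // mulg1 /surface_inj dfwith_in.
by rewrite IHs // /surface_inj dfwith_out // to1 mul1g.
Qed.

End SurfaceProdToZ2.

(* j < 2 singles out a_1, a_2 and b_1, b_2, since j starts from 0. *)
Definition phi_gen g (x : 'I_g + 'I_g) : Z2 :=
  match x with
  | inl j => if (j < 2)%N then Z2a else 1
  | inr j => if (j < 2)%N then Z2b else 1
  end.

Definition psi_gen h (x : 'I_h + 'I_h) : Z2 :=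
  match x with inl _ => Z2a | inr _ => Z2b end.

Definition phi r (g : 'I_r -> nat) : surface_prod g -> Z2 :=
  surface_prod_to_Z2 (fun i => @phi_gen (g i)).

Definition psi s (h : 'I_s -> nat) : surface_prod h -> Z2 :=
  surface_prod_to_Z2 (fun i => @psi_gen (h i)).

HB.instance Definition _ r (g : 'I_r -> nat) :=
  isUMagmaMorphism.Build (surface_prod g) Z2 (@phi r g)
    (surface_prod_to_Z21 _, surface_prod_to_Z2M _).

HB.instance Definition _ s (h : 'I_s -> nat) :=
  isUMagmaMorphism.Build (surface_prod h) Z2 (@psi s h)
    (surface_prod_to_Z21 _, surface_prod_to_Z2M _).

Lemma phi_a r (g : 'I_r -> nat) i (j : 'I_(g i)) :
  phi (surface_inj (surface_a j))
  = if (j < 2)%N then Z2a else 1.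
Proof. by rewrite /phi surface_prod_to_Z2_inj surface_to_Z2_a. Qed.

Lemma phi_b r (g : 'I_r -> nat) i (j : 'I_(g i)) :
  phi (surface_inj (surface_b j))
  = if (j < 2)%N then Z2b else 1.
Proof. by rewrite /phi surface_prod_to_Z2_inj surface_to_Z2_b. Qed.

Lemma psi_a s (h : 'I_s -> nat) i (j : 'I_(h i)) :
  psi (surface_inj (surface_a j)) = Z2a.
Proof. by rewrite /psi surface_prod_to_Z2_inj surface_to_Z2_a. Qed.

Lemma psi_b s (h : 'I_s -> nat) i (j : 'I_(h i)) :
  psi (surface_inj (surface_b j)) = Z2b.
Proof. by rewrite /psi surface_prod_to_Z2_inj surface_to_Z2_b. Qed.

Section Kernel.

Variables (G H : groupType) (f : UMagmaMorphism.type G H).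

Definition ker_pred : {pred G} := fun x => f x == 1.

Lemma ker_pred_closed : group_closed ker_pred.
Proof.
split=> [|x y]; first by rewrite unfold_in /ker_pred gmulf1.
by rewrite !unfold_in /ker_pred gmulfF => /eqP-> /eqP->; rewrite mulgV.
Qed.

Record kernel := Kernel { kernel_val :> G; _ : kernel_val \in ker_pred }.

HB.instance Definition _ := [isSub for kernel_val].
HB.instance Definition _ := [Choice of kernel by <:].
HB.instance Definition _ :=
  SubChoice_isSubGroup.Build G ker_pred kernel ker_pred_closed.

End Kernel.

Definition isomorphic (G H : groupType) : Prop :=
  exists f : {multiplicative G -> H}, bijective f.

(* Main.v *)
Require Import Defs.
From HB Require Import structures.
From mathcomp Require Import all_boot all_order all_algebra.
From mathcomp Require Import boolp zify ring.

(** The easy half is that for genus 2 the two homomorphisms are the same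
    function. For the converse, write a kernel as K in Lambda_1 x ... x Lambda_r,
    cut out by homomorphisms f_i : Lambda_i -> Z^2 that send a_1, a_2 to a and
    b_1, b_2 to b. An isomorphism of two such kernels has to permute the
    factors, and each factor Lambda_i remembers two numbers: its genus, read off
    the rank of its abelianization, and the degree of f_i, i.e. the integer
    sum_j det(f_i(a_j), f_i(b_j)) by which f_i acts on second homology. This
    degree is 2 for phi, and it is h_i for psi, so that an isomorphism forces
    h_i = 2 for all i, whence the g_i are 2 as well.

    All of this is visible in the largest class-2 nilpotent quotient, which is
    accessed by duality. A split form on a group G is a bihomomorphism
    B : G x G -> Z that is a coboundary, B(x, y) = q(xy) - q(x) - q(y); these
    forms are the kernel of the cup product on H^1(G), and they are transported
    by isomorphisms. On a surface group, a bihomomorphism is a split form as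
    soon as its antisymmetrization vanishes on sum_j a_j /\ b_j
    (surface_split_form); the proof maps the group to the Heisenberg-like
    central extension of itself defined by B.

    Call x and y form-commuting if B(x, y) = B(y, x) for every split form. In K
    this happens if and only if, in every factor, the images of x and y in
    H_1(Lambda_i) are proportional (form_commute_proj, parallel_form_commute).
    One direction uses that sum_j a_j /\ b_j has rank at least 4, so that none of
    its nonzero multiples is a decomposable bivector; the other one replaces x and y by
    elements with proportional exponents that really commute. Here r >= 3
    enters: any commutator of Lambda_i is a commutator of elements of K whose
    other coordinates live in different factors, so that a homomorphism K -> Z
    only depends on the classes in the H_1(Lambda_i) (char_vanish).

    If u and v in K are supported on factor i and not proportional there, their
    images are not proportional in some factor k; every w which is trivial in
    H_1(Lambda_i) form-commutes with u and v, hence its image is proportional in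
    factor k to two independent vectors, so trivial (vanish_factor). This
    gives the permutation of the factors, an isomorphism of the lattices
    H_1 in corresponding factors, hence equality of the genera by a trace
    computation (iso_genus). Finally, subtracting from the determinant form of
    the target the suitable multiple of a coordinate form produces a split form;
    its pullback to K shows that each of the two degrees divides the other
    (theta_degree). *)

Set Implicit Arguments.
Unset Strict Implicit.
Unset Printing Implicit Defensive.

(** * Characters and split forms *)
Section Characters.

Import GRing.Theory.
Local Open Scope ring_scope.
Local Open Scope group_scope.

Implicit Types G H : groupType.

Definition character G (chi : G -> int) :=
  forall x y, (chi (x * y)%g = chi x + chi y)%R.

Definition bicharacter G (B : G -> G -> int) :=
  (forall y, character (B^~ y)) /\ (forall x, character (B x)).

(** The bihomomorphisms whose class in H^2(G, Z) is trivial, that is, those whose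
    associated central extension of [G] splits. *)
Definition split_form G (B : G -> G -> int) :=
  bicharacter B /\ exists q : G -> int,
    forall x y, (q (x * y)%g = q x + q y + B x y)%R.

(** A substitute for commuting modulo the third term of the lower central
    series that is manifestly invariant under isomorphisms. *)
Definition form_commute G (x y : G) :=
  forall B, @split_form G B -> B x y = B y x.

Definition zpow G (x : G) (m : int) : G :=
  match m with Posz n => x ^+ n | Negz n => x ^- n.+1 end.

Section CharacterTheory.

Variables (G : groupType) (chi : G -> int).
Hypothesis chiM : character chi.

Lemma char1 : chi 1 = 0%R.
Proof. by apply: (addrI (chi 1)); rewrite -chiM mulg1 addr0. Qed.

Lemma charV x : chi x^-1 = (- chi x)%R.
Proof. by apply: (addrI (chi x)); rewrite -chiM mulgV subrr char1. Qed.

Lemma charF x y : chi (x * y^-1) = (chi x - chi y)%R.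
Proof. by rewrite chiM charV. Qed.

Lemma charR x y : chi [~ x, y] = 0%R.
Proof. rewrite !chiM !charV; ring. Qed.

Lemma charX x n : chi (x ^+ n) = (n%:Z * chi x)%R.
Proof.
elim: n => [|n IHn]; first by rewrite expg0 char1 mul0r.
by rewrite expgS chiM IHn; lia.
Qed.

Lemma char_zpow x m : chi (zpow x m) = (m * chi x)%R.
Proof.
case: m => n; first exact: charX.
by rewrite /= charV charX NegzE mulNr.
Qed.

Lemma char_prod I (s : seq I) (F : I -> G) :
  chi (\prod_(i <- s) F i) = (\sum_(i <- s) chi (F i))%R.
Proof. exact: (big_morph chi chiM char1). Qed.

End CharacterTheory.

Lemma commute_zpow G (x : G) m n : commute (zpow x m) (zpow x n).
Proof.
have nat_zpow k : commute x (zpow x k).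
  case: k => k; first exact/commuteX/commute_refl.
  exact/commuteV/commuteX/commute_refl.
suff step y k : commute y x -> commute y (zpow x k).
  exact/step/commute_sym/nat_zpow.
case: k => k yx; first exact: commuteX.
exact/commuteV/commuteX.
Qed.

Section BicharacterTheory.

Variables (G : groupType) (B : G -> G -> int).
Hypothesis Bbi : bicharacter B.

Let Bl y : character (B^~ y). Proof. by case: Bbi. Qed.
Let Br x : character (B x). Proof. by case: Bbi. Qed.

Lemma bichar1l y : B 1 y = 0%R. Proof. exact: char1 (Bl y). Qed.
Lemma bicharRl x y z : B [~ x, y] z = 0%R. Proof. exact: charR (Bl z) _ _. Qed.
Lemma bicharRr x y z : B z [~ x, y] = 0%R. Proof. exact: charR (Br z) _ _. Qed.

End BicharacterTheory.

Lemma char_comp G H (f : G -> H) (chi : H -> int) :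
  {morph f : x y / x * y} -> character chi -> character (fun x => chi (f x)).
Proof. by move=> fM chiM x y; rewrite fM chiM. Qed.

Lemma bichar_comp G H (f : G -> H) (B : H -> H -> int) :
  {morph f : x y / x * y} -> bicharacter B ->
  bicharacter (fun x y => B (f x) (f y)).
Proof. by move=> fM [Bl Br]; split=> x y z; rewrite fM (Bl, Br). Qed.

Lemma split_form_comp G H (f : G -> H) (B : H -> H -> int) :
  {morph f : x y / x * y} -> split_form B ->
  split_form (fun x y => B (f x) (f y)).
Proof.
move=> fM [Bbi [q qM]]; split; first exact: bichar_comp.
by exists (q \o f) => x y; rewrite /= fM qM.
Qed.

Lemma form_commute_morph G H (f : G -> H) x y :
  {morph f : x y / x * y} -> form_commute x y -> form_commute (f x) (f y).
Proof. by move=> fM xy B /(split_form_comp fM)/xy. Qed.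

Lemma split_form_commute G (B : G -> G -> int) x y :
  split_form B -> commute x y -> B x y = B y x.
Proof.
case=> _ [q qM] xy; have := qM x y; rewrite xy qM; lia.
Qed.

(** The splitting [q] is additive on products of commutators, where it takes the
    value [B x y - B y x] on [[~ x, y]]: each way of writing 1 as a product of
    commutators is a linear relation between the values of [B]. *)
Lemma split_form_prodR G (B : G -> G -> int) I (s : seq I) (x y : I -> G) :
  split_form B -> \prod_(i <- s) [~ x i, y i] = 1 ->
  (\sum_(i <- s) (B (x i) (y i) - B (y i) (x i)) = 0)%R.
Proof.
case=> Bbi [q qM].
have q1 : q 1 = 0%R by have := qM 1 1; rewrite mulg1 bichar1l //; lia.
have qR u v : q [~ u, v] = (B u v - B v u)%R.
  by have := qM (v * u) [~ u, v]; rewrite -commgC !qM bicharRr //; lia.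
suff -> : (\sum_(i <- s) (B (x i) (y i) - B (y i) (x i)))%R =
    q (\prod_(i <- s) [~ x i, y i]) by move=> ->.
elim: s => [|i s IHs]; first by rewrite !big_nil.
by rewrite !big_cons IHs qM bicharRl // qR addr0.
Qed.

End Characters.

(** * The central extension defined by a bihomomorphism *)
Section Heisenberg.

Import GRing.Theory.
Local Open Scope ring_scope.
Local Open Scope group_scope.

Variables (G : groupType) (B : G -> G -> int) (Bbi : bicharacter B).

(** The proof that [B] is a bihomomorphism is a parameter of the type so that the
    group structure can be inferred from the type. *)
Definition heisenberg of bicharacter B := (G * int)%type.

Local Notation heis := (heisenberg Bbi).

HB.instance Definition _ := Choice.on heis.

Let Bl y : character (B^~ y). Proof. by case: Bbi. Qed.
Let Br x : character (B x). Proof. by case: Bbi. Qed.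

Definition heis_one : heis := (1, 0%R).
Definition heis_mul (u v : heis) : heis :=
  (u.1 * v.1, (u.2 + v.2 + B u.1 v.1)%R).
Definition heis_inv (u : heis) : heis := (u.1^-1, (B u.1 u.1 - u.2)%R).

Lemma heis_mulA : associative heis_mul.
Proof.
move=> [x m] [y n] [z p]; rewrite /heis_mul /= mulgA; congr (_, _).
rewrite Bl Br; ring.
Qed.

Lemma heis_mul1 : left_id heis_one heis_mul.
Proof.
by move=> [x m]; rewrite /heis_mul /= mul1g bichar1l // add0r addr0.
Qed.

Lemma heis_mulr1 : right_id heis_one heis_mul.
Proof.
by move=> [x m]; rewrite /heis_mul /= mulg1 (char1 (Br x)) !addr0.
Qed.

Lemma heis_mulV : left_inverse heis_one heis_inv heis_mul.
Proof.
move=> [x m]; rewrite /heis_mul /heis_inv /= mulVg (charV (Bl x)).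
by congr (_, _); ring.
Qed.

Lemma heis_mulrV : right_inverse heis_one heis_inv heis_mul.
Proof.
move=> [x m]; rewrite /heis_mul /heis_inv /= mulgV (charV (Br x)).
by congr (_, _); ring.
Qed.

HB.instance Definition _ := isGroup.Build heis
  heis_mulA heis_mul1 heis_mulr1 heis_mulV heis_mulrV.

Lemma heisM (u v : heis) :
  u * v = (u.1 * v.1, (u.2 + v.2 + B u.1 v.1)%R) :> heis.
Proof. by []. Qed.

Lemma heisR (x y : G) (m n : int) :
  [~ (x, m) : heis, (y, n) : heis] = ([~ x, y], (B x y - B y x)%R) :> heis.
Proof.
pose u : heis := (x, m); pose v : heis := (y, n).
apply: (@mulgI heis (v * u)); rewrite -[v * u * _]commgC !heisM /=.
congr (_, _); first exact: commgC.
by rewrite bicharRr //; ring.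
Qed.

End Heisenberg.

(** * Surface groups *)
Section SurfaceGroup.

Import GRing.Theory.
Local Open Scope ring_scope.
Local Open Scope group_scope.

Variable g : nat.

Local Notation X := ('I_g + 'I_g)%type.
Local Notation Sg := (surface_group g).

Definition sgen (x : X) : Sg := pres_gen _ x.

Lemma eval_surface_relator (H : groupType) (f : X -> H) :
  eval_word f (surface_relator g) = \prod_(j < g) [~ f (inl j), f (inr j)].
Proof.
rewrite /surface_relator (big_morph _ (eval_word_cat f) (big_nil _ _ _ _)).
by apply: eq_bigr => j _; rewrite eval_word_comm !eval_word_gen.
Qed.

Section Lift.

Variables (H : groupType) (f : X -> H).
Hypothesis f_rel : \prod_(j < g) [~ f (inl j), f (inr j)] = 1.

Lemma relator_in : {in [:: surface_relator g], forall u, eval_word f u = 1}.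
Proof. by move=> u /[!inE] /eqP->; rewrite eval_surface_relator. Qed.

Definition surface_lift : Sg -> H := pres_lift f (rels := [:: surface_relator g]).

Lemma surface_liftM : {morph surface_lift : x y / x * y}.
Proof. exact: pres_liftM relator_in. Qed.

Lemma surface_lift_gen x : surface_lift (sgen x) = f x.
Proof. exact: pres_lift_gen relator_in _. Qed.

End Lift.

Lemma surface_ind (P : Sg -> Prop) :
  P 1 -> (forall x y, P y -> P (sgen x * y)) ->
  (forall x y, P y -> P ((sgen x)^-1 * y)) -> forall y, P y.
Proof.
move=> P1 Pg Pv y; rewrite -[y]pres_reprK; elim: (pres_repr y) => [//|[x e] w Pw].
rewrite -(cat1s (x, e)) pres_class_cat; case: e; last exact: Pg.
have -> : pres_class [:: surface_relator g] [:: (x, true)] = (sgen x)^-1.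
  by rewrite -pres_class_inv.
exact: Pv.
Qed.

Lemma surface_morph_ext (H : groupType) (f1 f2 : Sg -> H) :
  {morph f1 : x y / x * y} -> {morph f2 : x y / x * y} ->
  (forall x, f1 (sgen x) = f2 (sgen x)) -> f1 =1 f2.
Proof.
move=> f1M f2M f12.
have f1_1 : f1 1 = 1 by apply: (mulgI (f1 1)); rewrite -f1M !mulg1.
have f2_1 : f2 1 = 1 by apply: (mulgI (f2 1)); rewrite -f2M !mulg1.
apply: surface_ind => [|x y IHy|x y IHy]; first by rewrite f1_1.
  by rewrite f1M f2M f12 IHy.
rewrite f1M f2M IHy; congr (_ * _).
by apply: (mulgI (f1 (sgen x))); rewrite -f1M mulgV f12 -f2M mulgV f1_1.
Qed.

(** The exponent sum of a generator; the exponent sums of all generators are the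
    coordinates in H_1 of the surface. *)
Definition expsum (x : X) : Sg -> int :=
  @surface_lift (Algebra.to_multiplicative int) (fun y => (y == x)%:Z).

Let expsum_rel (f : X -> Algebra.to_multiplicative int) :
  \prod_(j < g) [~ f (inl j), f (inr j)] = 1.
Proof.
by apply: big1 => j _; apply/eqP/commgP; exact: (addrC (_ : int)).
Qed.

Lemma expsumM x : character (expsum x).
Proof. exact: surface_liftM (expsum_rel _). Qed.

Lemma expsum_gen x y : expsum x (sgen y) = (y == x)%:Z.
Proof. exact: surface_lift_gen (expsum_rel _) _. Qed.

Lemma expsum_class x (w : word X) :
  expsum x (pres_class _ w) =
  ((count_mem (x, false) w)%:Z - (count_mem (x, true) w)%:Z)%R.
Proof.
elim: w => [|[y e] w IHw]; first exact: char1 (@expsumM x).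
rewrite -(cat1s (y, e)) pres_class_cat expsumM IHw /= !xpair_eqE.
have yE : expsum x (pres_class _ [:: (y, false)]) = (y == x)%:Z.
  exact: expsum_gen.
have -> : expsum x (pres_class [:: surface_relator g] [:: (y, e)]) =
    (if e then - (y == x)%:Z else (y == x)%:Z)%R.
  case: e; last exact: yE.
  by rewrite -yE -(charV (@expsumM x)) -pres_class_inv.
by case: e; case: (y == x) => /=; lia.
Qed.

(** An induction principle for the commutator subgroup. If the exponent sums
    vanish, the first letter of a word occurs again with the opposite sign, and
    cancelling these two letters costs one commutator. *)
Lemma expsum_eq0_ind (P : Sg -> Prop) :
  P 1 -> (forall y z, P y -> P z -> P (y * z)) -> (forall y z, P [~ y, z]) ->
  forall y, (forall x, expsum x y = 0%R) -> P y.
Proof.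
move=> P1 PM PR y; rewrite -[y]pres_reprK; move: (pres_repr y) => w.
have [n] := ubnP (size w); elim: n w => // n IHn [|[x e] w] // w_n w0.
have w_x : (x, ~~ e) \in w.
  apply/negPn/negP => /count_memPn w'; have := w0 x.
  by rewrite expsum_class /= !xpair_eqE eqxx; case: e w' {w_n w0} => /= ->; lia.
case/splitPr: w / w_x w_n w0 => w1 w2 w_n w0.
set cl := pres_class _ in w0 *.
have clM u v : cl (u ++ v) = cl u * cl v by exact: pres_class_cat.
have clE : cl ((x, e) :: w1 ++ (x, ~~ e) :: w2) =
    [~ (cl [:: (x, e)])^-1, (cl w1)^-1] * cl (w1 ++ w2).
  rewrite -(cat1s (x, e)) -(cat1s (x, ~~ e) w2) !clM.
  have -> : cl [:: (x, ~~ e)] = (cl [:: (x, e)])^-1 by rewrite -pres_class_inv.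
  by rewrite commgEl conjgE !invgK !mulgA mulgVK.
rewrite clE; apply: PM; first exact: PR.
apply: IHn => [|z].
  by move: w_n; rewrite /= !size_cat /=; lia.
have := w0 z; rewrite clE expsumM charR ?add0r //; exact: expsumM.
Qed.

Lemma char_expsum0 (chi : Sg -> int) : character chi ->
  forall y, (forall x, expsum x y = 0%R) -> chi y = 0%R.
Proof.
move=> chiM; apply: expsum_eq0_ind => [|y z y0 z0|y z]; first exact: char1.
  by rewrite chiM y0 z0.
exact: charR.
Qed.

Lemma char_expsum_scale (chi : Sg -> int) n y z : character chi ->
  (forall x, expsum x y = n * expsum x z)%R -> (chi y = n * chi z)%R.
Proof.
move=> chiM yz; apply/eqP; rewrite -subr_eq0 -char_zpow // -charF //.
apply/eqP/char_expsum0 => // x; have xM := @expsumM x.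
by rewrite charF // char_zpow // yz subrr.
Qed.

(** The hypothesis says that the relator is trivial in the extension defined by
    [B], so that lifting each generator with second component 0 defines a
    section of the extension; its second component is the splitting. *)
Lemma surface_split_form (B : Sg -> Sg -> int) : bicharacter B ->
  (\sum_(j < g) (B (surface_a j) (surface_b j) - B (surface_b j) (surface_a j))
     = 0)%R -> split_form B.
Proof.
move=> Bbi B0; split=> //.
pose f x : heisenberg Bbi := (sgen x, 0%R).
have prodE (s : seq 'I_g) : \prod_(j <- s) [~ f (inl j), f (inr j)] =
    (\prod_(j <- s) [~ surface_a j, surface_b j],
     (\sum_(j <- s) (B (surface_a j) (surface_b j)
                     - B (surface_b j) (surface_a j)))%R) :> heisenberg Bbi.
  elim: s => [|j s IHs]; first by rewrite !big_nil.
  by rewrite !big_cons IHs heisR heisM /= bicharRl // addr0.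
have f_rel : \prod_(j < g) [~ f (inl j), f (inr j)] = 1.
  by rewrite prodE B0 surface_rel.
pose F := surface_lift f.
have FM : {morph F : x y / x * y} by exact: surface_liftM.
have F1 : (fun y => (F y).1) =1 id.
  apply: surface_morph_ext => // [x y|x]; first by rewrite FM.
  by rewrite /F surface_lift_gen.
by exists (fun y => (F y).2) => x y; rewrite FM /= [(F x).1]F1 [(F y).1]F1.
Qed.

End SurfaceGroup.

(** * Form-commuting elements of a surface group *)
Section Parallel.

Import GRing.Theory.
Local Open Scope ring_scope.
Local Open Scope group_scope.

Lemma bichar_tensor (G : groupType) (chi1 chi2 : G -> int) :
  character chi1 -> character chi2 ->
  bicharacter (fun x y => chi1 x * chi2 y)%R.
Proof.
by move=> M1 M2; split=> x y z; rewrite (M1, M2) (mulrDl, mulrDr).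
Qed.

Lemma bicharB (G : groupType) (B1 B2 : G -> G -> int) :
  bicharacter B1 -> bicharacter B2 -> bicharacter (fun x y => B1 x y - B2 x y)%R.
Proof.
by move=> [Bl1 Br1] [Bl2 Br2]; split=> x y z; rewrite ?Bl1 ?Bl2 ?Br1 ?Br2; ring.
Qed.

Lemma bicharZ (G : groupType) (n : int) (B : G -> G -> int) :
  bicharacter B -> bicharacter (fun x y => n * B x y)%R.
Proof. by move=> [Bl Br]; split=> x y z; rewrite ?Bl ?Br mulrDr. Qed.

(** Evaluation of the class of [B] on the fundamental class of the surface. *)
Definition omega g (B : surface_group g -> surface_group g -> int) : int :=
  (\sum_(j < g)
    (B (surface_a j) (surface_b j) - B (surface_b j) (surface_a j)))%R.

Definition parallel g (x y : surface_group g) :=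
  forall a b, (expsum a x * expsum b y = expsum b x * expsum a y)%R.

Lemma omegaB g (B1 B2 : surface_group g -> surface_group g -> int) :
  omega (fun x y => B1 x y - B2 x y)%R = (omega B1 - omega B2)%R.
Proof. by rewrite -sumrB; apply: eq_bigr => j _; ring. Qed.

Lemma omegaZ g n (B : surface_group g -> surface_group g -> int) :
  omega (fun x y => n * B x y)%R = (n * omega B)%R.
Proof. by rewrite mulr_sumr; apply: eq_bigr => j _; ring. Qed.

Lemma omega_expsum g (a b : 'I_g + 'I_g) :
  omega (fun x y => expsum a x * expsum b y)%R =
  match a, b with
  | inl i, inr j => (i == j)%:Z
  | inr i, inl j => (- (i == j)%:Z)%R
  | _, _ => 0
  end.
Proof.
rewrite /omega; under eq_bigr => j _ do rewrite !expsum_gen.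
case: a b => i [] j.
- by apply: big1 => k _; rewrite /eq_op /= mulr0 mul0r subr0.
- rewrite (bigD1 i) //= big1 => [|k ki].
    by rewrite /eq_op /= mul0r eqxx mul1r subr0 addr0.
  by rewrite /eq_op /= (negPf ki) !mul0r subr0.
- rewrite (bigD1 i) //= big1 => [|k ki].
    by rewrite /eq_op /= mul0r eqxx mul1r sub0r addr0.
  by rewrite /eq_op /= (negPf ki) !mul0r subr0.
- by apply: big1 => k _; rewrite /eq_op /= mulr0 mul0r subr0.
Qed.

Lemma expsum_tensor g (a b : 'I_g + 'I_g) :
  bicharacter (fun x y : surface_group g => expsum a x * expsum b y)%R.
Proof. by apply: bichar_tensor; exact: expsumM. Qed.

(** The 2 x 2 minors of the coordinate vectors of [x] and [y] can be tested by
    tensor products of exponent sums, which are split forms except for the pairs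
    [(a_i, b_i)]. For those, only differences of two such forms are split, so
    that the corresponding minors have a common value; it is 0 by the Pluecker
    relation on the coordinates [a_i, b_i, a_j, b_j]. *)
Lemma form_commute_parallel g (x y : surface_group g) :
  (1 < g)%N -> form_commute x y -> parallel x y.
Proof.
move=> g_gt1 xy.
have free a b : omega (fun u v : surface_group g => expsum a u * expsum b v)%R = 0 ->
    (expsum a x * expsum b y = expsum b x * expsum a y)%R.
  move=> /(surface_split_form (expsum_tensor a b))/xy ->; exact: mulrC.
have ll i j : (expsum (inl i) x * expsum (inl j) y
               = expsum (inl j) x * expsum (inl i) y)%R.
  by apply: free; rewrite omega_expsum.
have rr i j : (expsum (inr i) x * expsum (inr j) y
               = expsum (inr j) x * expsum (inr i) y)%R.
  by apply: free; rewrite omega_expsum.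
have lr i j : i != j -> (expsum (inl i) x * expsum (inr j) y
                         = expsum (inr j) x * expsum (inl i) y)%R.
  by move=> ij; apply: free; rewrite omega_expsum (negPf ij).
suff lr_eq i : (expsum (inl i) x * expsum (inr i) y
                = expsum (inr i) x * expsum (inl i) y)%R.
  have lr' i j : (expsum (inl i) x * expsum (inr j) y
                  = expsum (inr j) x * expsum (inl i) y)%R.
    by have [<-|] := eqVneq i j; [exact: lr_eq|exact: lr].
  by move=> [i|i] [j|j] //; rewrite mulrC [RHS]mulrC.
have [j ij] : exists j : 'I_g, i != j.
  have [i0|i0] := eqVneq (i : nat) 0%N.
    by exists (Ordinal g_gt1); rewrite -val_eqE /= i0.
  by exists (Ordinal (ltnW g_gt1)); rewrite -val_eqE.
pose m k := (expsum (inl k) x * expsum (inr k) y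
             - expsum (inr k) x * expsum (inl k) y)%R.
have mij : m i = m j.
  have /xy : split_form (fun u v => expsum (inl i) u * expsum (inr i) v
                                    - expsum (inl j) u * expsum (inr j) v)%R.
    apply: surface_split_form; first by apply: bicharB; exact: expsum_tensor.
    pose T k (u v : surface_group g) := (expsum (inl k) u * expsum (inr k) v)%R.
    by have := omegaB (T i) (T j); rewrite !omega_expsum !eqxx subrr.
  move=> /eqP; rewrite -subr_eq0 => /eqP E.
  by apply/eqP; rewrite -subr_eq0 -E /m; apply/eqP; ring.
(* the Pluecker relation, in which the terms other than m i * m j vanish *)
have : (m i * m j = 0)%R.
  have := ll i j; have := lr i j ij; rewrite /m.
  set p1 := expsum (inl i) x; set p2 := expsum (inr i) x.
  set p3 := expsum (inl j) x; set p4 := expsum (inr j) x.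
  set q1 := expsum (inl i) y; set q2 := expsum (inr i) y.
  set q3 := expsum (inl j) y; set q4 := expsum (inr j) y.
  move=> E14 E13.
  have -> : ((p1 * q2 - p2 * q1) * (p3 * q4 - p4 * q3) =
     (p1 * q3 - p3 * q1) * (p2 * q4 - p4 * q2)
     - (p1 * q4 - p4 * q1) * (p2 * q3 - p3 * q2))%R by ring.
  by rewrite E13 E14 !subrr !mul0r subrr.
by rewrite mij => /eqP; rewrite mulf_eq0 orbb -mij subr_eq0 => /eqP.
Qed.

End Parallel.

(** * Coabelian subgroups of products of surface groups *)
Section Coabelian.

Import GRing.Theory.
Local Open Scope ring_scope.
Local Open Scope group_scope.

(** The embedded group [K] is the kernel of the homomorphism to Z^2 that restricts
    to [(fa i, fb i)] on the i-th factor. Using two characters instead of a map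
    to Z^2 makes all arguments about homomorphisms arguments about characters,
    and an abstract embedding lets both kernels of the theorem, and both
    directions of an isomorphism, be treated alike. *)
Record coabelian (K : groupType) (r : nat) (g : 'I_r -> nat)
    (iota : K -> surface_prod g)
    (fa fb : forall i, surface_group (g i) -> int) : Prop := Coabelian {
  coab_r : (2 < r)%N;
  coab_g : forall i, (1 < g i)%N;
  iotaM : {morph iota : x y / x * y};
  iota_inj : injective iota;
  iota0 : forall w,
    (\sum_i fa i (iota w i) = 0)%R /\ (\sum_i fb i (iota w i) = 0)%R;
  iota_surj : forall x : surface_prod g,
    (\sum_i fa i (x i) = 0)%R -> (\sum_i fb i (x i) = 0)%R ->
    exists w, iota w = x;
  faM : forall i, character (@fa i);
  fbM : forall i, character (@fb i);
  coab_a : forall i (j : 'I_(g i)), (j < 2)%N ->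
    fa i (surface_a j) = 1%R /\ fb i (surface_a j) = 0%R;
  coab_b : forall i (j : 'I_(g i)), (j < 2)%N ->
    fa i (surface_b j) = 0%R /\ fb i (surface_b j) = 1%R
}.

Variables (K : groupType) (r : nat) (g : 'I_r -> nat).
Variables (iota : K -> surface_prod g).
Variables (fa fb : forall i, surface_group (g i) -> int).
Hypothesis KP : coabelian iota fa fb.

Lemma inj_in i (y : surface_group (g i)) : surface_inj y i = y.
Proof. by rewrite /surface_inj dfwith_in. Qed.

Lemma inj_out i (y : surface_group (g i)) l : l != i -> surface_inj y l = 1.
Proof. by rewrite eq_sym => il; rewrite /surface_inj dfwith_out. Qed.

Lemma inj_char (chi : forall i, surface_group (g i) -> int) i
    (y : surface_group (g i)) : (forall i, character (chi i)) ->
  (\sum_l chi l (surface_inj y l))%R = chi i y.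
Proof.
move=> chiM; rewrite (bigD1 i) //= inj_in big1 ?addr0 // => l li.
by rewrite inj_out // char1.
Qed.

Definition proj i (w : K) : surface_group (g i) := iota w i.

Lemma projM i : {morph proj i : x y / x * y}.
Proof. by move=> x y; rewrite /proj (iotaM KP). Qed.

Lemma proj_one i : proj i 1 = 1.
Proof. by apply: (mulgI (proj i 1)); rewrite -projM !mulg1. Qed.

Lemma projV i w : proj i w^-1 = (proj i w)^-1.
Proof. by apply: (mulgI (proj i w)); rewrite -projM !mulgV proj_one. Qed.

Lemma projR i v w : proj i [~ v, w] = [~ proj i v, proj i w].
Proof. by rewrite !projM !projV. Qed.

Lemma proj_inj v w : (forall i, proj i v = proj i w) -> v = w.
Proof.
by move=> vw; apply: (iota_inj KP); apply: functional_extensionality_dep.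
Qed.

Lemma factor_surj i (y : surface_group (g i)) : fa y = 0%R -> fb y = 0%R ->
  exists2 w, proj i w = y & forall l, l != i -> proj l w = 1.
Proof.
move=> fay fby.
have [||w wE] := iota_surj KP (x := surface_inj y).
- by rewrite inj_char //; exact: faM KP.
- by rewrite inj_char //; exact: fbM KP.
by exists w => [|l li]; rewrite /proj wE (inj_in, inj_out).
Qed.

(** As each factor surjects onto Z^2, the value of [y] can be compensated in any
    other factor [j]. *)
Lemma two_factor_lift i j (y : surface_group (g i)) : i != j ->
  exists2 w, proj i w = y & forall l, l != i -> l != j -> proj l w = 1.
Proof.
move=> ij.
have [aa ba] := coab_a KP (j := Ordinal (ltnW (coab_g KP j))) isT.
have [ab bb] := coab_b KP (j := Ordinal (ltnW (coab_g KP j))) isT.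
pose a := surface_a (Ordinal (ltnW (coab_g KP j))).
pose b := surface_b (Ordinal (ltnW (coab_g KP j))).
pose c : surface_group (g j) := zpow a (- fa y)%R * zpow b (- fb y)%R.
pose x : surface_prod g := surface_inj y * surface_inj c.
have xl l : x l = surface_inj y l * surface_inj c l by [].
have xE (chi : forall l, surface_group (g l) -> int) :
    (forall l, character (chi l)) ->
    (\sum_l chi l (x l) = chi i y - fa y * chi j a - fb y * chi j b)%R.
  move=> chiM; under eq_bigr => l _ do rewrite xl chiM.
  rewrite big_split /= !inj_char // chiM !char_zpow //; ring.
have [||w wE] := iota_surj KP (x := x).
- by rewrite xE; [rewrite aa ab; ring|exact: faM KP].
- by rewrite xE; [rewrite ba bb; ring|exact: fbM KP].
exists w => [|l li lj]; rewrite /proj wE xl.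
  by rewrite inj_in inj_out // mulg1.
by rewrite !inj_out // mulg1.
Qed.

Lemma proj_surj i (y : surface_group (g i)) : exists w, proj i w = y.
Proof.
have [j ij] : exists j : 'I_r, i != j.
  have r_gt1 := ltnW (coab_r KP).
  have [i0|i0] := eqVneq (i : nat) 0%N.
    by exists (Ordinal r_gt1); rewrite -val_eqE /= i0.
  by exists (Ordinal (ltnW r_gt1)); rewrite -val_eqE.
by have [w wE _] := two_factor_lift y ij; exists w.
Qed.

Lemma two_others (i : 'I_r) : exists j l : 'I_r, [/\ i != j, i != l & j != l].
Proof.
have r_gt2 := coab_r KP; have r_gt1 := ltnW r_gt2; have r_gt0 := ltnW r_gt1.
have [i0|i0|i0] := ltngtP (i : nat) 1%N.
- by exists (Ordinal r_gt1), (Ordinal r_gt2); rewrite -!val_eqE /=; split; lia.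
- by exists (Ordinal r_gt0), (Ordinal r_gt1); rewrite -!val_eqE /=; split; lia.
- by exists (Ordinal r_gt0), (Ordinal r_gt2); rewrite -!val_eqE /=; split; lia.
Qed.

(** Two lifts that are compensated in different factors have a commutator that
    is concentrated in the factor [i]; this takes three factors. *)
Lemma lift_commutator i : exists lift1 lift2 : surface_group (g i) -> K,
  [/\ forall y, proj i (lift1 y) = y, forall y, proj i (lift2 y) = y &
      forall y z l, l != i -> proj l [~ lift1 y, lift2 z] = 1].
Proof.
have [j [k [ij ik jk]]] := two_others i.
have [f1 f1E] := choice (fun y => let: ex_intro2 w p q := two_factor_lift y ij in
   ex_intro (fun w => proj i w = y /\ forall l, l != i -> l != j -> proj l w = 1)
     w (conj p q)).
have [f2 f2E] := choice (fun y => let: ex_intro2 w p q := two_factor_lift y ik in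
   ex_intro (fun w => proj i w = y /\ forall l, l != i -> l != k -> proj l w = 1)
     w (conj p q)).
exists f1, f2; split=> [y|y|y z l li]; [by case: (f1E y)|by case: (f2E y)|].
rewrite projR; have [lj|lj] := eqVneq l j.
  by rewrite (f2E z).2 ?commg1 // lj.
by rewrite (f1E y).2 ?comm1g.
Qed.

(** Triviality in the first homology of the i-th factor. *)
Definition vanish i w := forall a, expsum a (proj i w) = 0%R.

(** By [lift_commutator] the commutator subgroup of every factor lies in the
    commutator subgroup of [K], and [w] is a product of elements of these. *)
Lemma char_vanish (chi : K -> int) w :
  character chi -> (forall i, vanish i w) -> chi w = 0%R.
Proof.
move=> chiM w0.
have factor i (y : surface_group (g i)) : (forall a, expsum a y = 0%R) ->
    exists w, [/\ proj i w = y, forall l, l != i -> proj l w = 1 & chi w = 0%R].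
  move: y; apply: expsum_eq0_ind => [|y z [u [<- u1 u0]] [v [<- v1 v0]]|y z].
  - by exists 1; rewrite char1 // proj_one; split=> // l _; rewrite proj_one.
  - exists (u * v); rewrite projM chiM u0 v0; split=> // l li.
    by rewrite projM u1 // v1 // mulg1.
  - have [f1 [f2 [f1E f2E f12]]] := lift_commutator i.
    exists [~ f1 y, f2 z]; rewrite projR f1E f2E charR //; split=> // l.
    exact: f12.
suff part (s : seq 'I_r) v : (forall i, vanish i v) ->
    (forall i, i \notin s -> proj i v = 1) -> chi v = 0%R.
  by apply: (part (enum 'I_r)) => // i; rewrite mem_enum.
elim: s v {w w0} => [|i s IHs] v v0 v1.
  by rewrite (proj_inj (v := v) (w := 1)) ?char1 // => i; rewrite proj_one v1.
have [u [uv u1 u0]] := factor i (proj i v) (v0 i).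
rewrite -[v](mulgVK u) chiM u0 addr0.
have vuE l : proj l (v * u^-1) = if l == i then 1 else proj l v.
  rewrite projM projV; have [->|li] := eqVneq l i; first by rewrite uv mulgV.
  by rewrite u1 // invg1 mulg1.
apply: IHs => l; first move=> a; rewrite ?vuE.
  by case: eqP => // _; rewrite ?v0 // (char1 (@expsumM _ a)).
by case: eqP => // /eqP li ls; apply: v1; rewrite inE negb_or li.
Qed.

Lemma char_proj_scale (chi : K -> int) n v w : character chi ->
  (forall i a, expsum a (proj i v) = n * expsum a (proj i w))%R ->
  (chi v = n * chi w)%R.
Proof.
move=> chiM vw; apply/eqP; rewrite -subr_eq0 -char_zpow // -charF //.
apply/eqP/char_vanish => // i a.
have cM : character (fun w => expsum a (proj i w)).
  by move=> x y; rewrite projM expsumM.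
by rewrite (charF cM) (char_zpow cM) vw subrr.
Qed.

Lemma form_commute_proj i v w : form_commute v w -> parallel (proj i v) (proj i w).
Proof.
move=> vw; apply: form_commute_parallel; first exact: coab_g KP _.
by apply: form_commute_morph vw; exact: projM.
Qed.

(** Two proportional integer vectors become multiples of one of them after
    scaling; [N] only has to be nonzero because split forms take values in the
    torsion-free group Z. *)
Lemma parallel_power n (x y : surface_group n) : parallel x y ->
  exists c N m k, [/\ N <> 0%R :> int,
    forall a, (expsum a (zpow c m) = N * expsum a x)%R &
    forall a, (expsum a (zpow c k) = N * expsum a y)%R].
Proof.
move=> xy; have [x0|/existsNP[b /eqP xb]] := pselect (forall a, expsum a x = 0%R).
  exists y, 1%R, 0%R, 1%R; split=> // a.
  by rewrite (char_zpow (@expsumM _ a)) x0 mul0r mulr0.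
  exact: (char_zpow (@expsumM _ a)).
exists x, (expsum b x), (expsum b x), (expsum b y).
split=> [|a|a]; first exact/eqP.
  by rewrite (char_zpow (@expsumM _ a)).
by rewrite (char_zpow (@expsumM _ a)) mulrC xy.
Qed.

(** Some powers of [v] and [w] have the same exponent sums as elements [v'] and
    [w'] of [K] that are, in each factor, powers of one and the same element.
    Such elements commute, and by [char_vanish] bihomomorphisms do not see the
    difference. *)
Lemma parallel_form_commute v w :
  (forall i, parallel (proj i v) (proj i w)) -> form_commute v w.
Proof.
move=> vw B BT; have [[Bl Br] _] := BT.
pose c i := sval (cid (parallel_power (vw i))).
have cP i := svalP (cid (parallel_power (vw i))); rewrite -/(c _) in cP.
have [N NP] := choice cP; have [m mP] := choice NP; have [k kP] := choice mP.
pose M : int := (\prod_i N i)%R; pose M' i : int := (\prod_(j | j != i) N j)%R.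
have ME i : (M = N i * M' i)%R by rewrite /M (bigD1 i).
have M0 : M <> 0%R by apply/eqP/prodf_neq0 => i _; apply/eqP; case: (kP i).
pose x : surface_prod g := fun i => zpow (c i) (m i * M' i)%R.
pose y : surface_prod g := fun i => zpow (c i) (k i * M' i)%R.
(* M' i brings the scaling factors N i to the common value M *)
have cxy i a : (expsum a (x i) = M * expsum a (proj i v))%R
            /\ (expsum a (y i) = M * expsum a (proj i w))%R.
  have [_ /(_ a) mE /(_ a) kE] := kP i; have aM := @expsumM _ a.
  move: mE kE; rewrite !char_zpow // => mE kE.
  by rewrite (ME i) !(mulrAC _ (M' i)) -mE -kE.
have sumE (f : forall i, surface_group (g i) -> int) (u : surface_prod g) u' :
    (forall i, character (f i)) ->
    (forall i a, expsum a (u i) = M * expsum a (proj i u'))%R ->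
    (\sum_i f i (proj i u') = 0)%R -> (\sum_i f i (u i) = 0)%R.
  move=> fM uu f0; transitivity (\sum_i M * f i (proj i u'))%R.
    by apply: eq_bigr => i _; apply: char_expsum_scale => // a; exact: uu.
  by rewrite -mulr_sumr f0 mulr0.
have [v' v'E] : exists v', iota v' = x.
  have [va vb] := iota0 KP v.
  apply: (iota_surj KP); [apply: sumE va|apply: sumE vb];
    by [exact: faM KP|exact: fbM KP|move=> i a; case: (cxy i a)].
have [w' w'E] : exists w', iota w' = y.
  have [wa wb] := iota0 KP w.
  apply: (iota_surj KP); [apply: sumE wa|apply: sumE wb];
    by [exact: faM KP|exact: fbM KP|move=> i a; case: (cxy i a)].
have v'w' : commute v' w'.
  apply: proj_inj => i; rewrite !projM /proj v'E w'E.
  exact: commute_zpow.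
have vE chi : character chi -> (chi v' = M * chi v)%R.
  by move=> chiM; apply: char_proj_scale => // i a; rewrite /proj v'E; case: (cxy i a).
have wE chi : character chi -> (chi w' = M * chi w)%R.
  by move=> chiM; apply: char_proj_scale => // i a; rewrite /proj w'E; case: (cxy i a).
have := split_form_commute BT v'w'.
rewrite (vE _ (Bl _)) (wE _ (Br _)) (vE _ (Br _)) (wE _ (Bl _)) => E.
have /eqP M0' := M0; apply: (mulfI M0'); apply: (mulfI M0'); rewrite E.
ring.
Qed.

(** The defining relation of the i-th factor holds in [K] between the lifts of
    the generators, because the commutators of lifts are concentrated in this
    factor. *)
Lemma relation_lift i : exists A B : 'I_(g i) -> K,
  [/\ forall j, proj i (A j) = surface_a j, forall j, proj i (B j) = surface_b j &
      forall F, split_form F ->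
        (\sum_(j < g i) (F (A j) (B j) - F (B j) (A j)) = 0)%R].
Proof.
have [f1 [f2 [f1E f2E f12]]] := lift_commutator i.
exists (fun j => f1 (surface_a j)), (fun j => f2 (surface_b j)); split=> // F FT.
apply: split_form_prodR => //; apply: proj_inj => l.
rewrite proj_one (big_morph _ (@projM l) (proj_one l)).
have [->|li] := eqVneq l i; last by apply: big1 => j _; exact: f12.
by rewrite -[RHS]surface_rel; apply: eq_bigr => j _; rewrite projR f1E f2E.
Qed.

End Coabelian.

Arguments faM {K r g iota fa fb} _ i _ _.
Arguments fbM {K r g iota fa fb} _ i _ _.

(** * Invariants of a factor *)
Section Factor.

Import GRing.Theory.
Local Open Scope ring_scope.
Local Open Scope group_scope.

Variables (K : groupType) (r : nat) (g : 'I_r -> nat).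
Variables (iota : K -> surface_prod g).
Variables (fa fb : forall i, surface_group (g i) -> int).
Hypothesis KP : coabelian iota fa fb.

(** The elements [a_1 a_2^-1] and [b_1 b_2^-1] of the factor [i] are killed by
    [(fa i, fb i)], hence they belong to [K] without any compensation in another
    factor. *)
Lemma factor_pair i : exists u v : K,
  [/\ forall l, l != i -> proj iota l u = 1,
      forall l, l != i -> proj iota l v = 1 &
      ~ parallel (proj iota i u) (proj iota i v)].
Proof.
pose j0 := Ordinal (ltnW (coab_g KP i)); pose j1 := Ordinal (coab_g KP i).
have [a0a a0b] := coab_a KP (j := j0) isT.
have [a1a a1b] := coab_a KP (j := j1) isT.
have [b0a b0b] := coab_b KP (j := j0) isT.
have [b1a b1b] := coab_b KP (j := j1) isT.
have [||u uE u1] := factor_surj KP (y := surface_a j0 * (surface_a j1)^-1).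
- by rewrite (charF (faM KP i)) a0a a1a.
- by rewrite (charF (fbM KP i)) a0b a1b.
have [||v vE v1] := factor_surj KP (y := surface_b j0 * (surface_b j1)^-1).
- by rewrite (charF (faM KP i)) b0a b1a.
- by rewrite (charF (fbM KP i)) b0b b1b.
exists u, v; split=> // /(_ (inl j0) (inr j0)).
by rewrite uE vE !(charF (@expsumM _ _)) !expsum_gen.
Qed.

Lemma vanish_proj1 i w : proj iota i w = 1 -> vanish iota i w.
Proof. by move=> w1 a; rewrite w1 (char1 (@expsumM _ a)). Qed.

(** Distinct factors have distinct vanishing subgroups, because of the elements
    of [K] that are supported on a single factor. *)
Lemma vanish_inj i j :
  (forall w, vanish iota i w -> vanish iota j w) -> i = j.
Proof.
move=> ij; apply/eqP/negPn/negP => nij.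
have [u [v [u1 _ uv]]] := factor_pair j.
have u0 : vanish iota j u by apply/ij/vanish_proj1/u1.
by case: uv => a b; rewrite !u0 !mul0r.
Qed.

(** A character of [K] that factors through the homology of the k-th factor is
    determined by its values on lifts of the generators. *)
Lemma char_lift k (chi : K -> int) (s : 'I_(g k) + 'I_(g k) -> K) w :
  character chi -> (forall w, vanish iota k w -> chi w = 0%R) ->
  (forall y, proj iota k (s y) = sgen y) ->
  (chi w = \sum_y expsum y (proj iota k w) * chi (s y))%R.
Proof.
move=> chiM chi0 sE.
pose v := \prod_(y <- index_enum ('I_(g k) + 'I_(g k))%type)
            zpow (s y) (expsum y (proj iota k w)).
have vE (f : K -> int) : character f ->
    (f v = \sum_y expsum y (proj iota k w) * f (s y))%R.
  by move=> fM; rewrite char_prod //; apply: eq_bigr => y _; rewrite char_zpow.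
rewrite -(vE _ chiM); apply/eqP; rewrite -subr_eq0 -charF //.
apply/eqP/chi0 => a.
have aM : character (fun w => expsum a (proj iota k w)).
  by move=> x y; rewrite (projM KP) expsumM.
rewrite (charF aM) (vE _ aM) (bigD1 a) //= sE expsum_gen eqxx mulr1 big1 ?addr0 ?subrr //.
by move=> y ya; rewrite sE expsum_gen (negPf ya) mulr0.
Qed.

Definition dform i (x y : surface_group (g i)) : int :=
  (fa x * fb y - fb x * fa y)%R.

(** The degree of the map from the surface to the torus given by [(fa i, fb i)]. *)
Definition degree i : int :=
  (\sum_(j < g i) dform (surface_a j) (surface_b j))%R.

Lemma dform_bichar i : bicharacter (@dform i).
Proof.
by apply: bicharB; apply: bichar_tensor; by [exact: faM KP i|exact: fbM KP i].
Qed.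

Lemma omega_dform i : omega (@dform i) = (2 * degree i)%R.
Proof.
rewrite /omega /degree mulr_sumr; apply: eq_bigr => j _.
rewrite /dform; ring.
Qed.

End Factor.

(** * Transport along an isomorphism *)
Section Isomorphism.

Import GRing.Theory.
Local Open Scope ring_scope.
Local Open Scope group_scope.

Variables (K : groupType) (r : nat) (g : 'I_r -> nat).
Variables (iota : K -> surface_prod g).
Variables (fa fb : forall i, surface_group (g i) -> int).
Hypothesis KP : coabelian iota fa fb.

Variables (L : groupType) (s : nat) (h : 'I_s -> nat).
Variables (iota' : L -> surface_prod h).
Variables (fa' fb' : forall i, surface_group (h i) -> int).
Hypothesis LP : coabelian iota' fa' fb'.

Variables (theta : K -> L) (theta' : L -> K).
Hypotheses (thetaM : {morph theta : x y / x * y})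
           (theta'M : {morph theta' : x y / x * y})
           (thetaK : cancel theta theta').

(** With [u] and [v] independent in the factor [i] and trivial in the others,
    their images are independent in some factor [k]. If [w] vanishes in the
    factor [i] it form-commutes with [u] and [v], and a vector proportional to
    two independent ones is 0. *)
Lemma vanish_factor i : exists k,
  forall w, vanish iota i w -> vanish iota' k (theta w).
Proof.
have [u [v [u1 v1 uv]]] := factor_pair KP i.
have [k kP] : exists k, ~ parallel (proj iota' k (theta u))
                                   (proj iota' k (theta v)).
  apply/existsNP => par; apply: uv; apply: (form_commute_proj KP).
  rewrite -(thetaK u) -(thetaK v); apply: form_commute_morph => //.
  exact: (parallel_form_commute LP).
exists k => w w0.
have near x : (forall l, l != i -> proj iota l x = 1) ->
    parallel (proj iota' k (theta w)) (proj iota' k (theta x)).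
  move=> x1; apply: (form_commute_proj LP); apply: form_commute_morph => //.
  apply: (parallel_form_commute KP) => l.
  have [->|li] := eqVneq l i => a b; first by rewrite !w0 !mul0r.
  by rewrite x1 // !(char1 (@expsumM _ _)) !mulr0.
have [wu wv] := (near u u1, near v v1).
move/existsNP: kP => [a /existsNP[b /eqP]]; rewrite -subr_eq0 => m0 c.
apply: (mulIf m0); rewrite mul0r mulrBr !mulrA.
have /= ca := wu c a; have /= cb := wu c b; have /= ab := wv a b.
by rewrite ca cb -!mulrA !(mulrCA _ (expsum c _)) -mulrBr ab subrr mulr0.
Qed.

(** The matrices of [theta] and its inverse on the homology of the factors are
    inverse to each other; comparing the traces of their two products gives the
    equality of the ranks [2 * g i] and [2 * h k]. *)
Lemma iso_genus i k : cancel theta' theta ->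
  (forall w, vanish iota i w <-> vanish iota' k (theta w)) -> g i = h k.
Proof.
move=> theta'K ik.
have [lift liftE] := choice (fun x => proj_surj KP (sgen x : surface_group (g i))).
have [lift' lift'E] := choice (fun x => proj_surj LP (sgen x : surface_group (h k))).
pose F x y := expsum y (proj iota' k (theta (lift x))).
pose F' y x := expsum x (proj iota i (theta' (lift' y))).
have F1 x : (\sum_y F x y * F' y x = 1)%R.
  have := @char_lift _ _ _ _ _ _ LP k
    (fun w => expsum x (proj iota i (theta' w))) lift' (theta (lift x)).
  rewrite thetaK liftE expsum_gen eqxx => <- //.
  - by move=> v w; rewrite theta'M (projM KP) expsumM.
  - by move=> w; rewrite -{1}(theta'K w) => /ik.
have F'1 y : (\sum_x F' y x * F x y = 1)%R.
  have := @char_lift _ _ _ _ _ _ KP i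
    (fun w => expsum y (proj iota' k (theta w))) lift (theta' (lift' y)).
  rewrite theta'K lift'E expsum_gen eqxx => <- //.
  - by move=> v w; rewrite thetaM (projM LP) expsumM.
  - by move=> w /ik.
have : (\sum_(x : 'I_(g i) + 'I_(g i)) 1 = \sum_(y : 'I_(h k) + 'I_(h k)) 1 :> int)%R.
  under eq_bigr => x _ do rewrite -(F1 x).
  rewrite exchange_big; apply: eq_bigr => y _; rewrite -(F'1 y).
  by apply: eq_bigr => x _; exact: mulrC.
by rewrite !sumr_const !card_sum !card_ord; lia.
Qed.

Section Degree.

Variables (sigma : 'I_r -> 'I_s) (sigma' : 'I_s -> 'I_r).
Hypothesis (sigma'K : cancel sigma' sigma).
Hypothesis sigmaP :
  forall i w, vanish iota i w -> vanish iota' (sigma i) (theta w).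

(** Up to an element that vanishes in the factor [i], [w] is supported on this
    factor. The image then vanishes in all factors except [sigma i], and being
    in the kernel of the sum it is in the kernel of the [sigma i]-th summand. *)
Lemma theta_ker i w : fa (proj iota i w) = 0%R -> fb (proj iota i w) = 0%R ->
  fa' (proj iota' (sigma i) (theta w)) = 0%R /\
  fb' (proj iota' (sigma i) (theta w)) = 0%R.
Proof.
move=> wa wb; have [u uE u1] := factor_surj KP wa wb.
have wu : vanish iota' (sigma i) (theta w * (theta u)^-1).
  have -> : (theta u)^-1 = theta u^-1.
    apply: (mulgI (theta u)); rewrite mulgV -thetaM mulgV.
    by apply: (mulgI (theta 1)); rewrite -thetaM !mulg1.
  rewrite -thetaM; apply: sigmaP => a.
  have aM : character (fun w => expsum a (proj iota i w)).
    by move=> x y; rewrite (projM KP) expsumM.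
  by rewrite (charF aM) uE subrr.
suff vanish_char (f : forall k, surface_group (h k) -> int) :
    (forall k, character (f k)) ->
    (\sum_k f k (proj iota' k (theta u)) = 0)%R ->
    f _ (proj iota' (sigma i) (theta w)) = 0%R.
  have [ua ub] := iota0 LP (theta u).
  by split; apply: vanish_char => //; [exact: faM LP|exact: fbM LP].
move=> fM; rewrite (bigD1 (sigma i)) //= big1 ?addr0 => [<-|k ki].
  have fpM : character (fun w => f (sigma i) (proj iota' (sigma i) w)).
    by move=> x y; rewrite (projM LP) fM.
  by apply/eqP; rewrite -subr_eq0 -(charF fpM); apply/eqP/char_expsum0.
suff : vanish iota' k (theta u) by apply: char_expsum0.
rewrite -(sigma'K k); apply: sigmaP; apply: vanish_proj1.
by apply: u1; apply: contra_neq ki => <-; rewrite sigma'K.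
Qed.

(** By [theta_ker] the isomorphism induces an endomorphism of Z^2, of determinant
    [lambda], which relates the two determinant forms. The determinant form of
    the target evaluates to twice its degree on the fundamental class; minus that
    multiple of a coordinate form it is split, and its pullback to [K] satisfies
    the relation of [relation_lift]. *)
Lemma theta_degree i : exists lambda : int,
  (forall v w, dform fa' fb' (proj iota' (sigma i) (theta v))
                             (proj iota' (sigma i) (theta w))
    = lambda * dform fa fb (proj iota i v) (proj iota i w))%R /\
  exists c, (lambda * degree fa fb i = c * degree fa' fb' (sigma i))%R.
Proof.
pose j0 := Ordinal (ltnW (coab_g KP i)); pose k0 := Ordinal (ltnW (coab_g LP (sigma i))).
have [aa ab] := coab_a KP (j := j0) isT; have [ba bb] := coab_b KP (j := j0) isT.
have [u uE] := proj_surj KP (surface_a j0).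
have [v vE] := proj_surj KP (surface_b j0).
pose D x y := dform fa' fb' (proj iota' (sigma i) (theta x))
                            (proj iota' (sigma i) (theta y)).
have ptM : {morph (fun w => proj iota' (sigma i) (theta w)) : x y / x * y}.
  by move=> x y; rewrite thetaM (projM LP).
have faiM := char_comp (projM KP i) (faM KP i).
have fbiM := char_comp (projM KP i) (fbM KP i).
have chi_ker (chi : K -> int) w : character chi ->
    (forall w, fa (proj iota i w) = 0%R -> fb (proj iota i w) = 0%R ->
      chi w = 0%R) ->
    (chi w = fa (proj iota i w) * chi u + fb (proj iota i w) * chi v)%R.
  move=> chiM chi0.
  pose z := zpow u (fa (proj iota i w)) * zpow v (fb (proj iota i w)).
  have zE (f : K -> int) : character f ->
      (f z = fa (proj iota i w) * f u + fb (proj iota i w) * f v)%R.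
    by move=> fM; rewrite fM !char_zpow.
  rewrite -(zE _ chiM); apply/eqP; rewrite -subr_eq0 -charF //; apply/eqP/chi0.
    by rewrite (charF faiM) (zE _ faiM) uE vE aa ba; ring.
  by rewrite (charF fbiM) (zE _ fbiM) uE vE ab bb; ring.
have faE w : (fa' (proj iota' (sigma i) (theta w)) = _)%R :=
  chi_ker _ w (char_comp ptM (faM LP _)) (fun w wa wb => (theta_ker wa wb).1).
have fbE w : (fb' (proj iota' (sigma i) (theta w)) = _)%R :=
  chi_ker _ w (char_comp ptM (fbM LP _)) (fun w wa wb => (theta_ker wa wb).2).
have DE x y : (D x y = D u v * dform fa fb (proj iota i x) (proj iota i y))%R.
  by rewrite /D /dform (faE x) (fbE x) (faE y) (fbE y); ring.
exists (D u v); split; first exact: DE.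
have [A [B [AE BE AB]]] := relation_lift KP i.
pose E (x y : surface_group (h (sigma i))) :=
  (expsum (inl k0) x * expsum (inr k0) y)%R.
pose d' := degree fa' fb' (sigma i).
pose T x y := (dform fa' fb' x y - 2 * d' * E x y)%R.
have Tbi : bicharacter T.
  apply: bicharB; first exact: dform_bichar LP _.
  by apply: bicharZ; exact: expsum_tensor.
have T0 : omega T = 0%R.
  have := omegaB (@dform _ _ fa' fb' (sigma i)) (fun x y => 2 * d' * E x y)%R.
  rewrite -/T => ->; rewrite omegaZ omega_dform omega_expsum eqxx mulr1.
  by rewrite subrr.
have /AB := split_form_comp ptM (surface_split_form Tbi T0).
(* C is the value of the pulled back coordinate form on the fundamental class *)
pose C := (\sum_j (E (proj iota' (sigma i) (theta (A j)))
                     (proj iota' (sigma i) (theta (B j)))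
                  - E (proj iota' (sigma i) (theta (B j)))
                      (proj iota' (sigma i) (theta (A j)))))%R.
move=> sum0; exists C.
suff : (2 * (D u v * degree fa fb i) - 2 * (C * d') = 0)%R.
  rewrite -mulrBr => /eqP; rewrite mulf_eq0 /= subr_eq0 => /eqP.
  exact.
rewrite -[RHS]sum0 /C /degree mulr_suml !mulr_sumr -sumrB.
apply: eq_bigr => j _; rewrite /T -/(D (A j) (B j)) -/(D (B j) (A j)).
rewrite (DE (A j)) (DE (B j)) AE BE /dform; ring.
Qed.

End Degree.

End Isomorphism.

(** * Invariance of genus and degree *)
Section Classification.

Import GRing.Theory.
Local Open Scope ring_scope.
Local Open Scope group_scope.

Variables (K : groupType) (r : nat) (g : 'I_r -> nat).
Variables (iota : K -> surface_prod g).
Variables (fa fb : forall i, surface_group (g i) -> int).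
Hypothesis KP : coabelian iota fa fb.

Variables (L : groupType) (s : nat) (h : 'I_s -> nat).
Variables (iota' : L -> surface_prod h).
Variables (fa' fb' : forall i, surface_group (h i) -> int).
Hypothesis LP : coabelian iota' fa' fb'.

(** The determinants of the endomorphisms of Z^2 that are induced by the
    isomorphism and its inverse are inverse to each other, hence signs, so that
    [theta_degree] gives divisibility of the degrees in both directions. *)
Theorem coabelian_iso_invariants : isomorphic K L -> exists2 sigma : 'I_r -> 'I_s,
  bijective sigma &
  forall i, g i = h (sigma i) /\
    `|degree fa fb i|%N = `|degree fa' fb' (sigma i)|%N.
Proof.
case=> theta [theta' thetaK theta'K].
have thetaM : {morph theta : x y / x * y} by exact: gmulfM.
have theta'M : {morph theta' : x y / x * y}.
  by move=> x y; apply: (can_inj thetaK); rewrite thetaM !theta'K.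
have [sigma sP] := choice (vanish_factor KP LP thetaM theta'M thetaK).
have [sigma' s'P] := choice (vanish_factor LP KP theta'M thetaM theta'K).
have sigmaK : cancel sigma sigma'.
  move=> i; apply/esym/(vanish_inj KP) => w /sP/s'P; by rewrite thetaK.
have sigma'K : cancel sigma' sigma.
  move=> k; apply/esym/(vanish_inj LP) => w /s'P/sP; by rewrite theta'K.
exists sigma; first by exists sigma'.
move=> i.
have siP w : vanish iota i w <-> vanish iota' (sigma i) (theta w).
  by split=> [/sP//|/s'P]; rewrite thetaK sigmaK.
split; first exact: (iso_genus KP LP thetaM theta'M thetaK theta'K siP).
have [l [lE [c cE]]] := theta_degree KP LP thetaM sigma'K sP i.
have [l' [l'E [c' c'E]]] := theta_degree LP KP theta'M sigmaK s'P (sigma i).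
rewrite sigmaK in l'E c'E.
have ll : (l' * l = 1)%R.
  pose j0 := Ordinal (ltnW (coab_g KP i)).
  have [aa ab] := coab_a KP (j := j0) isT; have [ba bb] := coab_b KP (j := j0) isT.
  have [u uE] := proj_surj KP (surface_a j0).
  have [v vE] := proj_surj KP (surface_b j0).
  have := l'E (theta u) (theta v); rewrite !thetaK lE mulrA uE vE.
  rewrite /dform aa ab ba bb; move: (l' * l)%R => p; lia.
have abs1 (x y : int) : (x * y = 1)%R -> `|y|%N = 1%N.
  move=> /(congr1 absz); rewrite abszM => /eqP.
  by rewrite muln_eq1 => /andP[_ /eqP].
have l1 := abs1 _ _ ll; have l'1 : `|l'|%N = 1%N by apply: (abs1 l); rewrite mulrC.
move: (congr1 absz cE) (congr1 absz c'E).
rewrite !abszM l1 l'1 !mul1n => E1 E2; apply/eqP; rewrite eqn_dvd.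
by apply/andP; split; [rewrite E2|rewrite E1]; exact: dvdn_mull.
Qed.

End Classification.

(** * The kernels of phi and psi *)
Section Kernels.

Import GRing.Theory.
Local Open Scope ring_scope.
Local Open Scope group_scope.

Variables (r : nat) (g : 'I_r -> nat).
Variable f : forall i, 'I_(g i) + 'I_(g i) -> Z2.
Arguments f : clear implicits.

Definition Z2_fst i (x : surface_group (g i)) : int :=
  (surface_to_Z2 (f i) x : int * int).1.
Definition Z2_snd i (x : surface_group (g i)) : int :=
  (surface_to_Z2 (f i) x : int * int).2.

Lemma Z2_fstM i : character (@Z2_fst i).
Proof. by move=> x y; rewrite /Z2_fst surface_to_Z2M. Qed.

Lemma Z2_sndM i : character (@Z2_snd i).
Proof. by move=> x y; rewrite /Z2_snd surface_to_Z2M. Qed.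

Lemma surface_prod_to_Z2E x : surface_prod_to_Z2 f x =
  (\sum_i Z2_fst (x i), \sum_i Z2_snd (x i))%R :> (int * int)%type.
Proof.
rewrite /surface_prod_to_Z2; elim: (index_enum _) => [|i s IHs].
  by rewrite !big_nil.
by rewrite !big_cons IHs.
Qed.

End Kernels.

Section Final.

Import GRing.Theory.
Local Open Scope ring_scope.
Local Open Scope group_scope.

Lemma kernel_coabelian r (g : 'I_r -> nat)
    (f : forall i, 'I_(g i) + 'I_(g i) -> Z2)
    (F : UMagmaMorphism.type (surface_prod g) Z2) :
  F =1 surface_prod_to_Z2 f -> (2 < r)%N -> (forall i, 1 < g i)%N ->
  (forall i (j : 'I_(g i)), (j < 2)%N ->
    f i (inl j) = Z2a /\ f i (inr j) = Z2b) ->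
  coabelian (@kernel_val _ _ F) (@Z2_fst _ _ f) (@Z2_snd _ _ f).
Proof.
move=> FE r_gt2 g_gt1 fE; split=> //.
- exact: val_inj.
- move=> [w wF] /=; move: wF; rewrite unfold_in /ker_pred FE => /eqP.
  by rewrite surface_prod_to_Z2E => -[-> ->].
- move=> x xa xb; have xF : x \in ker_pred F.
    by rewrite unfold_in /ker_pred FE surface_prod_to_Z2E xa xb.
  by exists (Kernel xF).
- exact: Z2_fstM.
- exact: Z2_sndM.
- by move=> i j /fE[fa _]; rewrite /Z2_fst /Z2_snd surface_to_Z2_a fa.
- by move=> i j /fE[_ fb]; rewrite /Z2_fst /Z2_snd surface_to_Z2_b fb.
Qed.

Lemma isomorphic_kernel (G H : groupType) (f1 f2 : UMagmaMorphism.type G H) :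
  f1 =1 f2 -> isomorphic (kernel f1) (kernel f2).
Proof.
move=> f12.
have sub (a b : UMagmaMorphism.type G H) : a =1 b ->
    forall x : kernel a, kernel_val x \in ker_pred b.
  by move=> ab [x xP] /=; rewrite unfold_in /ker_pred -ab.
pose F (x : kernel f1) : kernel f2 := Kernel (sub _ _ f12 x).
pose F' (x : kernel f2) : kernel f1 := Kernel (sub _ _ (fsym f12) x).
have FM : {morph F : x y / x * y} by move=> x y; exact: val_inj.
pose fM := isMultiplicative.Build _ _ F FM.
pose Fm : {multiplicative kernel f1 -> kernel f2} := HB.pack F fM.
by exists Fm, F' => x; exact: val_inj.
Qed.

Lemma sum_lt2 g : (1 < g)%N ->
  (\sum_(j < g) (if (j < 2)%N then 1 else 0 : int) = 2)%R.
Proof.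
case: g => [|[|g]] // _; rewrite 2!big_ord_recl /= big1 //.
Qed.

(** The degree of [phi] on every factor is 2, and that of [psi] on the factor [i]
    is [h i]. *)
Theorem iso_phi_psi_genus2 r s (g : 'I_r -> nat) (h : 'I_s -> nat) :
  (2 < r)%N -> (2 < s)%N -> (forall i, 1 < g i)%N -> (forall i, 1 < h i)%N ->
  isomorphic (kernel (@phi r g)) (kernel (@psi s h)) ->
  [/\ r = s, forall i, g i = 2 & forall i, h i = 2].
Proof.
move=> r2 s2 g1 h1.
have KP : coabelian (@kernel_val _ _ (@phi r g)) (@Z2_fst _ _ (fun i => @phi_gen (g i)))
    (@Z2_snd _ _ (fun i => @phi_gen (g i))).
  by apply: kernel_coabelian => // i j /= ->.
have LP : coabelian (@kernel_val _ _ (@psi s h)) (@Z2_fst _ _ (fun i => @psi_gen (h i)))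
    (@Z2_snd _ _ (fun i => @psi_gen (h i))).
  by apply: kernel_coabelian.
move=> /(coabelian_iso_invariants KP LP)[sigma bij sP].
have degK i : degree (@Z2_fst _ _ (fun i => @phi_gen (g i)))
    (@Z2_snd _ _ (fun i => @phi_gen (g i))) i = 2%R.
  rewrite /degree -(sum_lt2 (g1 i)); apply: eq_bigr => j _.
  rewrite /dform /Z2_fst /Z2_snd surface_to_Z2_a surface_to_Z2_b /=.
  by case: ifP.
have degL i : degree (@Z2_fst _ _ (fun i => @psi_gen (h i)))
    (@Z2_snd _ _ (fun i => @psi_gen (h i))) i = (h i)%:Z.
  transitivity (\sum_(j < h i) (1 : int))%R; last by rewrite sumr_const card_ord natz.
  apply: eq_bigr => j _.
  by rewrite /dform /Z2_fst /Z2_snd surface_to_Z2_a surface_to_Z2_b.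
have hsig i : h (sigma i) = 2.
  by have [_] := sP i; rewrite degK degL.
have [sigma' sigmaK sigma'K] := bij.
split=> [|i|k].
- by rewrite -(card_ord r) -(card_ord s); apply: bij_eq_card bij.
- by have [-> _] := sP i.
- by rewrite -(sigma'K k).
Qed.

End Final.

Theorem corollary7p7 (r s : nat) (g : 'I_r -> nat) (h : 'I_s -> nat)
    (hr : 3 <= r) (hs : 3 <= s)
    (hg : forall i, 2 <= g i) (hh : forall i, 2 <= h i) :
  isomorphic (kernel (@phi r g)) (kernel (@psi s h)) <->
  [/\ r = s, forall i, g i = 2 & forall i, h i = 2].
Proof.
split=> [|[rs g2 h2]]; first exact: iso_phi_psi_genus2.
move: rs h hs hh h2 => <- h _ _ h2.
have -> : h = g by apply: functional_extensionality_dep => i; rewrite h2 g2.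
apply: isomorphic_kernel => x; rewrite /= /phi /psi.
apply: eq_bigr => i _; congr (surface_to_Z2 _ _).
apply: functional_extensionality_dep => -[] j /=.
all: by have := ltn_ord j; rewrite {2}g2 => ->.
Qed.
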